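(* Let $X$ be a set, let $k$ be a kernel on $X$ and let $s$ be a normalized complete Nevanlinna--Pick kernel on $X$ such that $k/s \ge 0$. Let $\mathcal{E}$ be a Hilbert space, let $\mathcal{N} \subset \mathcal{M} \subset \mathcal{H}_k \otimes \mathcal{E}$ be two non-zero closed subspaces and let $\mathcal{F}, \mathcal{G}$ be Hilbert spaces. If $\Phi \in \operatorname{Mult}(\mathcal{H}_s \otimes \mathcal{F}, \mathcal{H}_k \otimes \mathcal{E})$ and $\Psi \in \operatorname{Mult}(\mathcal{H}_s \otimes \mathcal{G}, \mathcal{H}_k \otimes \mathcal{E})$ are partially isometric multipliers with $\mathcal{M} = \Phi \cdot (\mathcal{H}_s \otimes \mathcal{F})$ and $\mathcal{N} = \Psi \cdot (\mathcal{H}_s \otimes \mathcal{G})$, then there exists a contractive multiplier $\Gamma \in \operatorname{Mult}(\mathcal{H}_s \otimes \mathcal{G}, \mathcal{H}_s \otimes \mathcal{F})$ with $\Psi = \Phi \Gamma$.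
   Context: All Hilbert spaces are complex. A kernel on a set $X$ is a positive semi-definite function $k : X \times X \to \mathbb{C}$, i.e. the matrix $[k(x_i,x_j)]$ is positive semi-definite for every finite subset $\{x_1,\dots,x_n\} \subset X$; this is written $k \ge 0$. $\mathcal{H}_k$ denotes the reproducing kernel Hilbert space on $X$ with kernel $k$, so $\langle f, k(\cdot,x)\rangle = f(x)$ for $f \in \mathcal{H}_k$, $x \in X$. A kernel $s$ is normalized if there is $x_0 \in X$ with $s(x,x_0) = 1$ for all $x \in X$. A normalized kernel $s$ is a complete Nevanlinna--Pick kernel if and only if $s$ is non-vanishing and $1 - 1/s \ge 0$ (this may be taken as the definition). Here $1/s$ and $k/s$ denote pointwise quotients on $X \times X$. For a Hilbert space $\mathcal{E}$, elements of $\mathcal{H}_k \otimes \mathcal{E}$ are regarded as $\mathcal{E}$-valued functions on $X$. For kernels $\ell, k$ on $X$ and Hilbert spaces $\mathcal{F}, \mathcal{E}$, $\operatorname{Mult}(\mathcal{H}_\ell \otimes \mathcal{F}, \mathcal{H}_k \otimes \mathcal{E})$ is the space of functions $\Phi : X \to \mathcal{B}(\mathcal{F},\mathcal{E})$ that multiply $\mathcal{H}_\ell \otimes \mathcal{F}$ into $\mathcal{H}_k \otimes \mathcal{E}$ (pointwise: $(\Phi f)(x) = \Phi(x) f(x)$). Such $\Phi$ is called contractive (respectively partially isometric) if the multiplication operator $M_\Phi : \mathcal{H}_\ell \otimes \mathcal{F} \to \mathcal{H}_k \otimes \mathcal{E}$ is contractive (respectively a partial isometry). $\Phi \cdot (\mathcal{H}_\ell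 \otimes \mathcal{F})$ denotes the range of $M_\Phi$. Products of operator-valued functions such as $\Phi\Gamma$ are pointwise. *)

(* Defs.v *)
From HB Require Import structures.
From mathcomp Require Import all_boot all_order all_algebra.
From mathcomp Require Export complex.
From mathcomp Require Export all_classical all_reals all_analysis.
Import Order.TTheory GRing.Theory Num.Theory.
Import numFieldNormedType.Exports.

Set Implicit Arguments.
Unset Strict Implicit.
Unset Printing Implicit Defensive.

Local Open Scope classical_set_scope.
Local Open Scope ring_scope.
Local Open Scope complex_scope.
Local Open Scope sesquilinear_scope.

(* A complex Hilbert space is a Banach space over R[i] whose norm comes from an
   inner product. In {dot H for conjC} the form is linear in its first argument
   and conjugate-linear in the second. *)
HB.mixin Record isHilbert (R : realType) H
    of CompleteNormedModule R[i] H := {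
  hdot : {dot H for (@Num.conj R[i])} ;
  normE_hdot : forall u : H, `|u| ^+ 2 = hdot u u
}.

#[short(type="hilbertType")]
HB.structure Definition Hilbert (R : realType) :=
  {H of isHilbert R H & CompleteNormedModule R[i] H}.

Notation "''[' u , v ]" := (hdot u%R v%R) : ring_scope.

Section Operators.
Context {R : realType}.
Implicit Types H K : hilbertType R.

Definition contractive H K (A : H -> K) := forall u, `|A u| <= `|u|.

Definition partial_isometry H K (A : H -> K) :=
  forall u, (forall v, A v = 0 -> '[u, v] = 0) -> `|A u| = `|u|.

Definition closed_subspace H (M : set H) := submod_closed (mem M) /\ closed M.

End Operators.

Section Kernels.
Context {R : realType} {X : Type}.
Implicit Types k s : X -> X -> R[i].

(* The order of R[i] is partial: 0 <= z says that z is real and nonnegative. *)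
Definition psdmx n (A : 'M[R[i]]_n) :=
  forall v : 'rV[R[i]]_n, 0 <= (v *m A *m v ^t*) 0 0.

Definition is_kernel k :=
  forall n (x : 'I_n -> X), psdmx (\matrix_(i, j) k (x i) (x j)).

Definition normalized s := exists x0, forall x, s x x0 = 1.

Definition complete_NP s :=
  (forall x y, s x y != 0) /\ is_kernel (fun x y => 1 - (s x y)^-1).

(* The reproducing kernel Hilbert space of k, which is unique up to a unitary
   map that respects the evaluations: a Hilbert space whose elements f are the
   functions x |-> rkhs_eval x f on X, containing each k(., x) as kfun x. *)
Record rkhs k := Rkhs {
  rkhs_space :> hilbertType R ;
  rkhs_eval : X -> {linear rkhs_space -> R[i]^o} ;
  rkhs_eval_inj : forall f g, (forall x, rkhs_eval x f = rkhs_eval x g) -> f = g ;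
  kfun : X -> rkhs_space ;
  kfunE : forall x y, rkhs_eval y (kfun x) = k y x ;
  reproducing : forall f x, '[f, kfun x] = rkhs_eval x f
}.

(* The Hilbert space tensor product of H and E. *)
Record hilbert_tensor (H E : hilbertType R) := HilbertTensor {
  tensor_space :> hilbertType R ;
  tens : {bilinear H -> E -> tensor_space} ;
  hdot_tens : forall f g e e',
    '[tens f e, tens g e'] = '[f, g] * '[e, e'] ;
  tens_dense : dense [set t : tensor_space |
    exists n (f : 'I_n -> H) (e : 'I_n -> E), t = \sum_i tens (f i) (e i)]
}.

(* The tensor product of the RKHS of k with E, its elements regarded as
   E-valued functions on X: evaluation at x is the bounded operator determined
   by (f (x) e)(x) = f(x) e on elementary tensors. *)
Record rkhs_tensor k (Hk : rkhs k) (E : hilbertType R) := RkhsTensor {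
  rkhs_tensor_space :> hilbert_tensor Hk E ;
  teval : X -> {linear rkhs_tensor_space -> E} ;
  teval_continuous : forall x, continuous (teval x) ;
  teval_tens : forall x f e,
    teval x (tens rkhs_tensor_space f e) = (rkhs_eval Hk x f : R[i]) *: e
}.

Section Multipliers.
Context {l k : X -> X -> R[i]} {Hl : rkhs l} {Hk : rkhs k}.
Context {F E : hilbertType R}.
Variables (LF : rkhs_tensor Hl F) (KE : rkhs_tensor Hk E).
Implicit Type Phi : X -> {linear F -> E}.

Definition product_of Phi (f : LF) : set KE :=
  [set g | forall x, teval KE x g = Phi x (teval LF x f)].

Definition multiplier Phi :=
  (forall x, continuous (Phi x)) /\ (forall f, product_of Phi f !=set0).

(* For a multiplier Phi, product_of Phi f has exactly one element. *)
Definition mult_op Phi (f : LF) : KE := xget 0 (product_of Phi f).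

End Multipliers.
End Kernels.

Arguments product_of {R X l k Hl Hk F E} LF KE Phi f.
Arguments multiplier {R X l k Hl Hk F E} LF KE Phi.
Arguments mult_op {R X l k Hl Hk F E} LF KE Phi f.

(* Main.v *)
From HB Require Import structures.
Require Import Defs.
From mathcomp Require Import all_boot all_order all_algebra.
From mathcomp Require Import ring lra.
Import Order.TTheory GRing.Theory Num.Theory.
Import numFieldNormedType.Exports.
Set Implicit Arguments.
Unset Strict Implicit.
Unset Printing Implicit Defensive.
Local Open Scope classical_set_scope.
Local Open Scope complex_scope.
Local Open Scope ring_scope.

(** The theorem is a form of Leech's factorization theorem, and the plan is to
    build the adjoints Gamma(x)^* one vector at a time.

    Write s_y for the kernel function at y.  A function Gamma is a contractive
    multiplier with Psi = Phi Gamma as soon as the vectors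
    g = Gamma(y)^* f satisfy two conditions: Gamma(y)^* Phi(y)^* = Psi(y)^*, and
    the map sending s_y (x) f to s_y (x) Gamma(y)^* f is contractive on the span
    of these vectors.  So we study relations T, sets of triples (y, f, g) read as
    g = Gamma(y)^* f, and call T contractive if
      |sum c_i s_(y_i) (x) g_i| <= |sum c_i s_(y_i) (x) f_i|
    for all finite families of triples of T.  Contractivity already forces g to
    be a function of (y, f), linear and contractive in f.

    Start.  The triples (y, Phi(y)^* e, Psi(y)^* e) form a contractive relation
    ([adjoint_relation_contractive]).  Indeed the two sums are M_Phi^* h and
    M_Psi^* h for one and the same h, and the inclusion of the final spaces of
    the partial isometries gives M_Psi M_Psi^* <= M_Phi M_Phi^*.

    Extension.  Given a contractive relation T and (y, f0), some g0 keeps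
    T together with (y, f0, g0) contractive
    ([contractive_one_point_extension]); this is where the complete
    Nevanlinna-Pick property enters.  It says that the kernel
      1 - s(x, y) s(y, z) / (s(x, z) s(y, y))
    is positive semi-definite for every y ([psd_pick_matrix]); hence, by Schur
    products, the contractive map defined by T stays contractive after removing
    from both sides the component along s_y ([graph_span_compression]).
    What remains is to choose the component of the image along s_y (x) G, and a
    suitable g0 is read off the minimiser of a strongly convex function, in the
    spirit of Parrott's completion lemma.

    End.  By Zorn's lemma there is a contractive relation containing the initial
    one and defined at every (y, f) ([contractive_relation_total]).  It is the
    graph of the adjoints of the required multiplier
    ([contractive_multiplier_of_relation]).

    All Hilbert space existence results (Riesz representation, orthogonal
    projection, the choice of g0) come from one minimisation principle,
    [strongly_convex_minimiser]. *)

(** * Real inner product and squared norm *)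

Section InnerProduct.
Context {R : realType}.
Implicit Types H K : hilbertType R.

Lemma hdotDl H (u v w : H) : '[u + v, w] = '[u, w] + '[v, w].
Proof. exact: (linearDl hdot). Qed.

Lemma hdotZl H (a : R[i]) (u v : H) : '[a *: u, v] = a * '[u, v].
Proof. by rewrite (linearZl_LR hdot). Qed.

Lemma hdotC H (u v : H) : '[u, v] = ('[v, u])^*.
Proof. by rewrite (hermC hdot) expr0 mul1r. Qed.

Lemma hdotDr H (u v w : H) : '[u, v + w] = '[u, v] + '[u, w].
Proof. exact: (linearDr hdot). Qed.

Lemma hdotZr H (a : R[i]) (u v : H) : '[u, a *: v] = a^* * '[u, v].
Proof. by rewrite (linearZr_LR hdot). Qed.

Lemma hdot_suml H I (r : seq I) (f : I -> H) v :
  '[\sum_(i <- r) f i, v] = \sum_(i <- r) '[f i, v].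
Proof. exact: (linear_sumlz hdot). Qed.

Lemma hdot_sumr H I (r : seq I) (f : I -> H) v :
  '[v, \sum_(i <- r) f i] = \sum_(i <- r) '[v, f i].
Proof. exact: (linear_sumr hdot). Qed.

Lemma hdot0l H (v : H) : '[0, v] = 0.
Proof. exact: (linear0l hdot). Qed.

(** The real part of the inner product, and [sqnorm] its diagonal, take
    values in the ordered field R: estimates can then be settled by real
    arithmetic instead of in the partial order of R[i]. *)
Definition rdot H (u v : H) : R := complex.Re '[u, v].
Definition sqnorm H (u : H) : R := rdot u u.

Lemma rdotDl H (u v w : H) : rdot (u + v) w = rdot u w + rdot v w.
Proof. by rewrite /rdot hdotDl raddfD. Qed.
Lemma rdotC H (u v : H) : rdot u v = rdot v u.
Proof. by rewrite /rdot hdotC; case: '[v, u]. Qed.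
Lemma rdotDr H (u v w : H) : rdot u (v + w) = rdot u v + rdot u w.
Proof. by rewrite 3!(rdotC u) rdotDl. Qed.
Lemma rdotZl H (a : R) (u v : H) : rdot (a%:C *: u) v = a * rdot u v.
Proof. by rewrite /rdot hdotZl; case: '[u, v] => x y /=; rewrite mul0r subr0. Qed.
Lemma rdotZr H (a : R) (u v : H) : rdot u (a%:C *: v) = a * rdot u v.
Proof. by rewrite rdotC rdotZl rdotC. Qed.
Lemma rdotNl H (u v : H) : rdot (- u) v = - rdot u v.
Proof. by rewrite -scaleN1r -(rmorphN1 (real_complex R)) rdotZl mulN1r. Qed.
Lemma rdotNr H (u v : H) : rdot u (- v) = - rdot u v.
Proof. by rewrite rdotC rdotNl rdotC. Qed.
Definition rdotE := (rdotDl, rdotDr, rdotNl, rdotNr, rdotZl, rdotZr).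

Lemma sqnormD H (u v : H) : sqnorm (u + v) = sqnorm u + 2 * rdot u v + sqnorm v.
Proof. by rewrite /sqnorm !rdotE (rdotC v u); ring. Qed.
Lemma sqnormN H (u : H) : sqnorm (- u) = sqnorm u.
Proof. by rewrite /sqnorm !rdotE opprK. Qed.
Lemma sqnormB H (u v : H) : sqnorm (u - v) = sqnorm u - 2 * rdot u v + sqnorm v.
Proof. by rewrite sqnormD sqnormN rdotNr; ring. Qed.
Lemma sqnormZr H (a : R) (u : H) : sqnorm (a%:C *: u) = a ^+ 2 * sqnorm u.
Proof. by rewrite /sqnorm !rdotE; ring. Qed.

Lemma hdot_sqnorm H (u : H) : '[u, u] = (sqnorm u)%:C.
Proof.
rewrite /sqnorm /rdot; have /(congr1 (@complex.Im R)) := hdotC u u.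
case: '[u, u] => x y /= /eqP; rewrite -subr_eq0 opprK -mulr2n mulrn_eq0 /=.
by move=> /eqP ->.
Qed.

Lemma norm_sqnorm H (u : H) : `|u| ^+ 2 = (sqnorm u)%:C.
Proof. by rewrite normE_hdot hdot_sqnorm. Qed.

Lemma sqnorm_ge0 H (u : H) : 0 <= sqnorm u.
Proof. by rewrite -lecR -norm_sqnorm exprn_ge0. Qed.

Lemma sqnorm_eq0 H (u : H) : sqnorm u = 0 -> u = 0.
Proof.
move=> u0; apply/normr0_eq0/eqP; rewrite -sqrf_eq0 norm_sqnorm u0.
by rewrite eqxx.
Qed.

Lemma sqnormZ H (a : R[i]) (u : H) :
  sqnorm (a *: u) = (complex.Re a ^+ 2 + complex.Im a ^+ 2) * sqnorm u.
Proof.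
apply: complexI; rewrite -norm_sqnorm normrZ exprMn norm_sqnorm.
by rewrite -add_Re2_Im2 -rmorphM.
Qed.

Lemma ler_norm_sqnorm H K (u : H) (v : K) :
  (`|u| <= `|v|) = (sqnorm u <= sqnorm v).
Proof. by rewrite -(@ler_pXn2r _ 2) ?nnegrE // !norm_sqnorm lecR. Qed.

Lemma ltr_norm_sqnorm H (u : H) (r : R) : 0 <= r ->
  (`|u| < r%:C) = (sqnorm u < r ^+ 2).
Proof.
by move=> r0; rewrite -(@ltr_pXn2r _ 2) ?nnegrE ?lecR // norm_sqnorm -rmorphXn ltcR.
Qed.

(** Applied to an identity of linear functionals, this recovers it from its
    real part on all scalar multiples. *)
Lemma complex_Re_eq (z w : R[i]) :
  (forall a, complex.Re (a * z) = complex.Re (a * w)) -> z = w.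
Proof.
case: z w => x y [x' y'] h; have /= := h 1; have /= := h 'i.
by rewrite !mul0r !mul1r !sub0r !subr0 => /oppr_inj -> ->.
Qed.

Lemma hdot_inj (H : hilbertType R) (u v : H) :
  (forall w, '[w, u] = '[w, v]) -> u = v.
Proof.
move=> h; apply/eqP; rewrite -subr_eq0; apply/eqP/sqnorm_eq0.
by rewrite {1}/sqnorm rdotDr rdotNr /rdot h subrr.
Qed.

Lemma rdot_sqr_le H (u v : H) : rdot u v ^+ 2 <= sqnorm u * sqnorm v.
Proof.
have h (t : R) : 0 <= sqnorm (t%:C *: u - v) by exact: sqnorm_ge0.
have [/sqnorm_eq0 ->|u0] := eqVneq (sqnorm u) 0.
  rewrite /sqnorm /rdot !hdot0l /=.
  by rewrite expr2 !mul0r.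
have up : 0 < sqnorm u by rewrite lt_def u0 sqnorm_ge0.
have := h (rdot u v / sqnorm u); rewrite sqnormB sqnormZr rdotZl.
set a := sqnorm u in u0 up *; set b := rdot u v; set c := sqnorm v.
have -> : (b / a) ^+ 2 * a - 2 * (b / a * b) + c = (a * c - b ^+ 2) / a by field.
by rewrite pmulr_lge0 ?invr_gt0 // subr_ge0.
Qed.

End InnerProduct.

(** * Topology of a Hilbert space through squared norms *)

Section HilbertTopology.
Context {R : realType}.
Implicit Types H K : hilbertType R.

Lemma ltr_norm_sqrt H (u : H) (e : R) : 0 < e ->
  (`|u| < (Num.sqrt e)%:C) = (sqnorm u < e).
Proof. by move=> e0; rewrite ltr_norm_sqnorm ?sqrtr_ge0 // sqr_sqrtr ?ltW. Qed.

Lemma hilbert_complete H (u : nat -> H) :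
  (forall e : R, 0 < e -> exists N, forall n, (N <= n)%N -> sqnorm (u n - u N) < e) ->
  exists x : H, forall e : R, 0 < e -> exists N, forall n, (N <= n)%N -> sqnorm (u n - x) < e.
Proof.
move=> uC; have /cauchy_cvg/cvg_ex[x ux] : cauchy (u @ \oo).
  apply: cauchy_exP => e; rewrite ltcE /= => /andP[/eqP e0 er].
  have -> : e = (complex.Re e)%:C by move: e0; case: e {er} => a b /= ->.
  have [N hN] := uC (complex.Re e ^+ 2) (exprn_gt0 _ er).
  exists (u N), N => // n /= /hN h; rewrite -ball_normE /=.
  by rewrite distrC ltr_norm_sqnorm // ltW.
exists x => e e0; have se : 0 < (Num.sqrt e)%:C :> R[i].
  by rewrite -[0]/(0%:C) ltcR sqrtr_gt0.
have /cvgrPdist_lt /(_ _ se) [N _ hN] := ux.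
by exists N => n /hN /=; rewrite distrC ltr_norm_sqrt.
Qed.

Lemma dense_sqnorm H (D : set H) (h : H) (e : R) : dense D -> 0 < e ->
  exists2 t, D t & sqnorm (h - t) < e.
Proof.
move=> dD e0; have se : 0 < (Num.sqrt e)%:C :> R[i].
  by rewrite -[0]/(0%:C) ltcR sqrtr_gt0.
have [|t [bt Dt]] := dD (ball h (Num.sqrt e)%:C) _ (ball_open h _).
  by exists h; exact: ballxx.
by exists t => //; rewrite -ltr_norm_sqrt //; move: bt; rewrite -ball_normE.
Qed.

Lemma continuous_sqnorm_bounded H K (A : {linear H -> K}) : continuous A ->
  exists C : R, 0 <= C /\ forall u, sqnorm (A u) <= C * sqnorm u.
Proof.
move=> /linear_bounded_continuous /linear_boundedP [M [Mreal hM]].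
pose r : R[i] := (complex.Re M + 1)%:C.
have Mr : M < r.
  rewrite /r -(RRe_real Mreal) /= ltcR; lra.
exists ((complex.Re M + 1) ^+ 2); split => [|u]; first exact: sqr_ge0.
have := hM r Mr u; rewrite -lecR rmorphM /= rmorphXn /= -!norm_sqnorm -exprMn => h.
by rewrite ler_pXn2r // nnegrE ?(le_trans _ h).
Qed.

Lemma sqnorm_bounded_continuous H K (A : {linear H -> K}) (C : R) : 0 <= C ->
  (forall u, sqnorm (A u) <= C * sqnorm u) -> continuous A.
Proof.
move=> C0 hA; apply/linear_bounded_continuous/linear_boundedP.
exists (Num.sqrt C)%:C; split; first by apply/complex_realP; exists (Num.sqrt C).
move=> r Cr u; apply: (@le_trans _ _ ((Num.sqrt C)%:C * `|u|)); last first.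
  by rewrite ler_wpM2r // ltW.
have s0 : 0 <= (Num.sqrt C)%:C :> R[i] by rewrite -[0]/(0%:C) lecR sqrtr_ge0.
rewrite -(@ler_pXn2r _ 2) ?nnegrE ?mulr_ge0 // exprMn !norm_sqnorm.
by rewrite -rmorphXn -rmorphM /= sqr_sqrtr // lecR.
Qed.

End HilbertTopology.

(** * Minimisation of strongly convex functions *)

Section Minimisation.
Context {R : realType}.
Implicit Types H K : hilbertType R.

(** Weighted form of the triangle inequality: the weight e lets a term
    tending to 0 be absorbed without square roots. *)
Lemma sqnormD_le H (a b : H) (e : R) : 0 < e ->
  sqnorm (a + b) <= (1 + e) * sqnorm a + (1 + e^-1) * sqnorm b.
Proof.
move=> e0; have := sqnorm_ge0 (e%:C *: a - b).
rewrite sqnormB sqnormZr rdotZl sqnormD => h.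
have h2 : 2 * rdot a b <= e * sqnorm a + e^-1 * sqnorm b.
  rewrite -(ler_pM2l e0) mulrDr [e * (e^-1 * _)]mulrA mulfV ?gt_eqF //.
  lra.
lra.
Qed.

Lemma archi_inv (e : R) : 0 < e -> exists n : nat, forall p, (n <= p)%N -> (p.+2%:R)^-1 < e.
Proof.
move=> e0; exists (Num.bound e^-1) => p np.
rewrite invf_plt ?posrE ?ltr0n //.
apply: (lt_le_trans (archi_boundP _)); first by rewrite invr_ge0 ltW.
by rewrite ler_nat; do 2 apply: leqW.
Qed.

(** A strongly convex J >= 0 has a minimiser in the completion, with
    quadratic growth around it: J(w) is at least inf J plus the squared
    distance of u(w) to the minimiser. To see it, let w_n nearly minimise J;
    the hypothesis with a small t at w_n and w bounds the squared distance
    of u(w_n) to u(w) by J(w) - inf J up to a factor and an error tending to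
    1 and 0. Taking w = w_p makes u(w_n) a Cauchy sequence, and the bound
    passes to its limit. In the applications T is a subspace and u a linear
    map on it, and J is a quadratic function whose leading part dominates
    the squared norm of u. *)
Lemma strongly_convex_minimiser (T : Type) H (J : T -> R) (u : T -> H) :
  inhabited T -> (forall w, 0 <= J w) ->
  (forall w w' (t : R), 0 < t < 1 -> exists w'',
     J w'' <= (1 - t) * J w + t * J w' - t * (1 - t) * sqnorm (u w' - u w)) ->
  exists x : H, (forall w, sqnorm (u w - x) <= J w) /\
    forall e : R, 0 < e -> exists w, sqnorm (u w - x) < e.
Proof.
move=> [t0] J0 Jconv; pose m := inf (range J).
have hinf : has_inf (range J).
  split; first by exists (J t0), t0.
  by exists 0 => _ [w _ <-].
have m_le w : m <= J w by apply: ge_inf; [exact: hinf.2|exists w].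
have m0 : 0 <= m.
  by apply: lb_le_inf; [exact: hinf.1|move=> _ [w _ <-]].
pose d (n : nat) : R := (n.+2%:R)^-1.
have d0 n : 0 < d n by rewrite invr_gt0 ltr0n.
have d2 n : 2 * d n <= 1.
  by rewrite mulrC ler_pdivrMl ?ltr0n // mulr1 ler_nat.
have d_le n p : (n <= p)%N -> d p <= d n.
  by move=> np; rewrite lef_pV2 ?posrE ?ltr0n // ler_nat.
have /choice[w hw] n : exists w, J w < m + d n ^+ 2.
  have [_ [w _ <-] hw] := inf_adherent (exprn_gt0 2 (d0 n)) hinf.
  by exists w.
(* The step d n = 1 / (n + 2) is at most 1/2, which keeps 1 - d n away from 0
   and allows the division by d n in the convexity inequality. *)
have key n v : (1 - d n) * sqnorm (u v - u (w n)) <= J v - m + d n.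
  have dn := d0 n; have d2n := d2 n.
  have [|w'' hw''] := Jconv (w n) v (d n); first by lra.
  have := m_le w''; have := hw n; set q := sqnorm _ in hw'' *.
  move=> h1 h2; rewrite -(ler_pM2l dn).
  suff : (1 - d n) * J (w n) <= (1 - d n) * (m + d n ^+ 2) by nra.
  by rewrite ler_wpM2l ?(ltW h1) //; lra.
have [|x hx] := @hilbert_complete R H (u \o w).
  move=> e e0; have [N hN] := archi_inv (divr_gt0 e0 (ltr0n R 4)).
  exists N => p Np /=; have /= := key N (w p); have := hw p.
  have := hN N (leqnn N); have := d_le _ _ Np; rewrite -/(d N).
  have := d0 N; have := d0 p; have := d2 N; have := d2 p.
  have := sqnorm_ge0 (u (w p) - u (w N)); set q := sqnorm _.
  move=> *; nra.
exists x; split; last first.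
  by move=> e /hx [N /(_ N (leqnn N)) hN]; exists (w N).
move=> v; have Jv := J0 v.
(* The passage to the limit with an explicit error, linear in e: the weight e in
   [sqnormD_le] goes with a distance to the limit below e. *)
have small e : 0 < e -> 2 * e <= 1 -> sqnorm (u v - x) <= J v + e * (4 * J v + 5).
  move=> e0 e2; have [N1 hN1] := hx _ (exprn_gt0 2 e0).
  have [N2 hN2] := archi_inv e0.
  pose n := maxn N1 N2; have /= hb := hN1 n (leq_maxl _ _).
  have dne : d n < e := hN2 n (leq_maxr _ _).
  have := key n v; have dn := d0 n.
  have := sqnormD_le (u v - u (w n)) (u (w n) - x) e0; rewrite addrA subrK.
  have := sqnorm_ge0 (u v - u (w n)); have := m0.
  set a := sqnorm (u v - u (w n)); set b := sqnorm (u (w n) - x) in hb *.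
  move=> {}m0 a0 hS ha.
  have hb' : (1 + e^-1) * b <= e ^+ 2 + e.
    have -> : e ^+ 2 + e = (1 + e^-1) * e ^+ 2 by field; rewrite gt_eqF.
    rewrite ler_wpM2l ?(ltW hb) // addr_ge0 // invr_ge0 ltW //.
  have ha' : a <= (J v + e) * (1 + 2 * e).
    have h1 : (1 - e) * a <= J v + e.
      have : 0 <= (e - d n) * a by apply: mulr_ge0; lra.
      by lra.
    have h2 : ((1 - e) * a) * (1 + 2 * e) <= (J v + e) * (1 + 2 * e).
      by rewrite ler_wpM2r //; lra.
    have h3 : 0 <= a * e * (1 - 2 * e) by do ?apply: mulr_ge0; lra.
    by lra.
  have h4 : (1 + e) * a <= (1 + e) * ((J v + e) * (1 + 2 * e)).
    by rewrite ler_wpM2l //; lra.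
  have h5 : 0 <= (J v + e) * (e * (1 - 2 * e)).
    by do ?apply: mulr_ge0; lra.
  have h6 : 0 <= e * (1 - 2 * e) by apply: mulr_ge0; lra.
  by lra.
have [//|lt] := leP (sqnorm (u v - x)) (J v).
pose D := sqnorm (u v - x) - J v; have D0 : 0 < D by rewrite subr_gt0.
pose M := 4 * J v + 5; have M0 : 0 < M by rewrite /M; lra.
pose e := Num.min 2^-1 (D / (2 * M)).
have e0 : 0 < e by rewrite lt_min invr_gt0 ltr0n divr_gt0 // mulr_gt0.
have e2 : e <= 2^-1 by rewrite ge_min lexx.
have eM : e <= D / (2 * M) by rewrite ge_min lexx orbT.
have eM' : e * M <= D / 2.
  by apply: le_trans (ler_wpM2r (ltW M0) eM) _; rewrite le_eqVlt; apply/orP; left; apply/eqP; field; rewrite gt_eqF.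
have /(small e e0) : 2 * e <= 1 by lra.
rewrite -/M => h; exfalso; rewrite /D in D0 eM'; lra.
Qed.
End Minimisation.

(** * Riesz representation and orthogonal decomposition *)

Section Riesz.
Context {R : realType}.
Implicit Types H K : hilbertType R.

Definition subspace (V : lmodType R[i]) (Z : set V) :=
  Z 0 /\ forall (a : R[i]) u v, Z u -> Z v -> Z (a *: u + v).

Lemma sqnorm_convex H (t : R) (u v : H) :
  sqnorm ((1 - t)%:C *: u + t%:C *: v) =
  (1 - t) * sqnorm u + t * sqnorm v - t * (1 - t) * sqnorm (v - u).
Proof.
by rewrite (sqnormD (_ *: u)) !sqnormZr rdotZl rdotZr sqnormB (rdotC v u); ring.
Qed.

Lemma affine_le_cst (p q : R) : (forall t, t * p <= q) -> p = 0.
Proof.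
move=> h; apply/eqP/negPn/negP => p0; have := h ((q + 1) / p).
by rewrite mulrVK ?unitfE //; lra.
Qed.

(** The representing vector minimises the quadratic function below. Its
    nonnegativity is a form of boundedness of phi on Z that is free of
    square roots, with norm at most the square root of c. The approximation
    clause puts h in the closure of the image of Z; for a closed subspace
    this yields the orthogonal projection. *)
Lemma riesz_on (V : lmodType R[i]) (Z : set V) H (A : V -> H) (phi : V -> R[i]) (c : R) :
  subspace Z ->
  (forall a u v, A (a *: u + v) = a *: A u + A v) ->
  (forall a u v, phi (a *: u + v) = a * phi u + phi v) ->
  (forall w, Z w -> 0 <= sqnorm (A w) - 2 * complex.Re (phi w) + c) ->
  exists h : H, [/\ forall w, Z w -> '[A w, h] = phi w, sqnorm h <= c &
    forall e : R, 0 < e -> exists2 w, Z w & sqnorm (A w - h) < e].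
Proof.
move=> [Z0 ZL] AL phiL J0.
have ZZ a u : Z u -> Z (a *: u) by move=> Zu; rewrite -[_ *: _]addr0; exact: ZL.
have A0 : A 0 = 0 by have := AL (-1) 0 0; rewrite scaler0 addr0 scaleN1r addNr.
have AZ a u : A (a *: u) = a *: A u by rewrite -[_ *: u]addr0 AL A0 addr0.
have phi0 : phi 0 = 0 by have := phiL (-1) 0 0; rewrite scaler0 addr0 mulN1r addNr.
have phiZ a u : phi (a *: u) = a * phi u by rewrite -[_ *: u]addr0 phiL phi0 addr0.
have [] := @strongly_convex_minimiser R {w | Z w} H
  (fun w => sqnorm (A (sval w)) - 2 * complex.Re (phi (sval w)) + c) (fun w => A (sval w)).
- by split; exists 0.
- by case=> w Zw /=; exact: J0.
- move=> [w Zw] [w' Zw'] t /= _.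
  exists (exist _ _ (ZL (1 - t)%:C _ _ Zw (ZZ t%:C _ Zw'))) => /=.
  rewrite AL phiL AZ phiZ; set x := A w; set y := A w'.
  have -> : complex.Re ((1 - t)%:C * phi w + t%:C * phi w') =
            (1 - t) * complex.Re (phi w) + t * complex.Re (phi w').
    by case: (phi w) (phi w') => a b [a' b'] /=; rewrite !mul0r !subr0.
  by rewrite sqnorm_convex le_eqVlt; apply/orP; left; apply/eqP; ring.
move=> x [hx happ].
have {}hx w : Z w -> sqnorm x - 2 * rdot (A w) x <= c - 2 * complex.Re (phi w).
  by move=> Zw; have := hx (exist _ w Zw); rewrite /= sqnormB; lra.
have xc : sqnorm x <= c.
  by have := hx 0 Z0; rewrite A0 phi0 /rdot hdot0l /=; lra.
exists x; split=> //; last first.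
  by move=> e /happ [[w Zw] /= hw]; exists w.
(* Growth at the multiples t w of w: an affine function of t bounded on the
   whole line is constant. *)
have re w : Z w -> rdot (A w) x = complex.Re (phi w).
  move=> Zw; apply/eqP; rewrite -subr_eq0; apply/eqP.
  rewrite -[LHS]opprK; apply/eqP; rewrite oppr_eq0; apply/eqP.
  apply: (@affine_le_cst _ (c / 2)) => t; have := hx _ (ZZ t%:C _ Zw).
  rewrite AZ phiZ rdotZl.
  have -> : complex.Re (t%:C * phi w) = t * complex.Re (phi w).
    by case: (phi w) => a b /=; rewrite mul0r subr0.
  by have := sqnorm_ge0 x; lra.
move=> w Zw; apply: complex_Re_eq => a.
by rewrite -hdotZl -AZ -phiZ; apply: re; exact: ZZ.
Qed.

Lemma bounded_adjoint_vector H K (A : H -> K) (C : R) (v : K) : 0 <= C ->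
  (forall a x y, A (a *: x + y) = a *: A x + A y) ->
  (forall x, sqnorm (A x) <= C * sqnorm x) ->
  exists u : H, forall x, '[A x, v] = '[x, u].
Proof.
move=> C0 AL hC.
have [||||u [hu _ _]] := @riesz_on H (@classical_sets.setT H) H id (fun x => '[A x, v]) (C * sqnorm v).
- by split.
- by [].
- by move=> a x y; rewrite AL hdotDl hdotZl.
- move=> x _; have := rdot_sqr_le (A x) v; have := sqnorm_ge0 v; have := hC x.
  rewrite -/(rdot (A x) v); set r := rdot _ _; set a := sqnorm (A x).
  set b := sqnorm x; set d := sqnorm v => ab d0 h.
  have {}h : r ^+ 2 <= C * b * d by apply: le_trans h _; rewrite ler_wpM2r.
  have b0 : 0 <= b by exact: sqnorm_ge0.
  have : 0 <= C * d by exact: mulr_ge0.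
  set k := C * d => k0; have {}h : r ^+ 2 <= b * k by rewrite /k; lra.
  rewrite leNgt; apply/negP => lt.
  have : 0 < (2 * r - (b + k)) * (2 * r + (b + k)) by apply: mulr_gt0; lra.
  by have := sqr_ge0 (b - k); lra.
by exists u => x; rewrite hu.
Qed.

Lemma adjoint_vector H K (A : {linear H -> K}) (v : K) : continuous A ->
  exists u : H, forall x, '[A x, v] = '[x, u].
Proof.
move=> /continuous_sqnorm_bounded [C [C0 hC]].
by apply: (bounded_adjoint_vector v C0 _ hC) => a x y; rewrite linearP.
Qed.

(** The projection of f to Z represents the functional given by the inner
    product with f on Z. *)
Lemma orthogonal_decomposition H (Z : set H) (f : H) : subspace Z ->
  (forall x, (forall e : R, 0 < e -> exists2 w, Z w & sqnorm (w - x) < e) -> Z x) ->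
  exists2 x, Z x & forall w, Z w -> '[f - x, w] = 0.
Proof.
move=> subZ clZ.
have [|||x [hx _ /clZ Zx]] := @riesz_on H Z H id (fun x => '[x, f]) (sqnorm f) subZ.
- by [].
- by move=> a x y; rewrite hdotDl hdotZl.
- by move=> w _; rewrite -/(rdot w f) -sqnormB sqnorm_ge0.
exists x => // w Zw; rewrite hdotC -scaleN1r hdotDr hdotZr hx //.
by rewrite rmorphN1 mulN1r subrr rmorph0.
Qed.

End Riesz.

(** * Kernel vectors in the tensor product of an RKHS and a Hilbert space *)

Section TensorReproducing.
Context {R : realType} {X : Type}.

Lemma dense_hdot_eq (H : hilbertType R) (D : set H) (u v : H) : dense D ->
  (forall t, D t -> '[t, u] = '[t, v]) -> u = v.
Proof.
move=> dD h; apply/eqP; rewrite -subr_eq0; apply/eqP/sqnorm_eq0.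
apply/eqP; rewrite eq_le sqnorm_ge0 andbT leNgt; apply/negP => /(dense_sqnorm (u - v) dD).
move=> [t /h ht]; have : rdot (u - v) t = 0.
  by rewrite rdotC rdotDr rdotNr /rdot ht subrr.
by have := sqnorm_ge0 t; rewrite sqnormB; lra.
Qed.

Context {k : X -> X -> R[i]} {Hk : rkhs k} {E : hilbertType R}.
Variable KE : rkhs_tensor Hk E.

(** The reproducing property for vector-valued functions. Both sides are
    bounded functionals of f that agree on elementary tensors. *)
Lemma teval_reproducing x (f : KE) (e : E) :
  '[f, tens KE (kfun Hk x) e] = '[teval KE x f, e].
Proof.
have [u hu] := adjoint_vector e (@teval_continuous _ _ _ _ _ KE x).
rewrite hu; suff -> : u = tens KE (kfun Hk x) e by [].
apply: dense_hdot_eq (@tens_dense _ _ _ KE) _ => _ [n [g [e' ->]]].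
rewrite !hdot_suml; apply: eq_bigr => i _.
by rewrite -hu hdot_tens teval_tens reproducing hdotZl.
Qed.

Lemma sqnorm_tens (f : Hk) (e : E) : sqnorm (tens KE f e) = sqnorm f * sqnorm e.
Proof. by apply: complexI; rewrite rmorphM /= -!hdot_sqnorm hdot_tens. Qed.

(** Elements of the tensor product are determined by their values: for fixed
    e, pairing f with h (x) e is a bounded conjugate-linear functional of h,
    hence represented by an element of the scalar RKHS whose values are
    those of f paired with e. *)
Lemma teval_inj (f g : KE) : (forall x, teval KE x f = teval KE x g) -> f = g.
Proof.
move=> fg; apply: dense_hdot_eq (@tens_dense _ _ _ KE) _ => _ [n [h [e ->]]].
rewrite !hdot_suml; apply: eq_bigr => i _; move: (h i) (e i) => {}h {}e.
have adj (v : KE) : exists u : Hk, forall h, '[tens KE h e, v] = '[h, u].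
  apply: (@bounded_adjoint_vector _ _ _ (fun h => tens KE h e) (sqnorm e)).
  - exact: sqnorm_ge0.
  - by move=> a x y; rewrite linearDl linearZl_LR.
  - by move=> x; rewrite sqnorm_tens mulrC.
have [u hu] := adj f; have [v hv] := adj g; rewrite hu hv.
suff -> : u = v by [].
apply: (@rkhs_eval_inj _ _ _ Hk) => x; rewrite -!reproducing.
by rewrite hdotC -hu hdotC conjCK teval_reproducing fg -teval_reproducing hdotC hv -hdotC.
Qed.

End TensorReproducing.

Section MultOp.
Context {R : realType} {X : Type} {l k : X -> X -> R[i]} {Hl : rkhs l} {Hk : rkhs k}.
Context {F E : hilbertType R} (LF : rkhs_tensor Hl F) (KE : rkhs_tensor Hk E).
Variable Phi : X -> {linear F -> E}.
Hypothesis hPhi : multiplier LF KE Phi.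

Lemma teval_mult_op x f : teval KE x (mult_op LF KE Phi f) = Phi x (teval LF x f).
Proof. exact: (xgetPex 0 (hPhi.2 f)). Qed.

Lemma mult_opP f g : (forall x, teval KE x g = Phi x (teval LF x f)) ->
  mult_op LF KE Phi f = g.
Proof. by move=> h; apply: teval_inj => x; rewrite teval_mult_op h. Qed.

Lemma mult_opL a f g :
  mult_op LF KE Phi (a *: f + g) = a *: mult_op LF KE Phi f + mult_op LF KE Phi g.
Proof. by apply: mult_opP => x; rewrite !linearP !teval_mult_op. Qed.

(** The kernel of a multiplication operator consists of the f with Phi(x)
    f(x) = 0 for all x, a closed condition since evaluations and Phi(x) are
    bounded. *)
Lemma mult_op_kernel_closed (f : LF) :
  (forall e : R, 0 < e -> exists2 w, mult_op LF KE Phi w = 0 & sqnorm (w - f) < e) ->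
  mult_op LF KE Phi f = 0.
Proof.
move=> happ; apply: mult_opP => x; rewrite linear0; apply/esym/sqnorm_eq0.
have [C [C0 hC]] := continuous_sqnorm_bounded (@teval_continuous _ _ _ _ _ LF x).
have [D [D0 hD]] := continuous_sqnorm_bounded (hPhi.1 x).
have bound w : mult_op LF KE Phi w = 0 ->
    sqnorm (Phi x (teval LF x f)) <= D * C * sqnorm (w - f).
  move=> w0; have w0x : Phi x (teval LF x w) = 0 by rewrite -teval_mult_op w0 linear0.
  rewrite -[teval LF x f](subKr (teval LF x w)) -linearB (linearB (Phi x)) w0x sub0r.
  by rewrite sqnormN (le_trans (hD _)) // -mulrA ler_wpM2l.
apply/eqP; rewrite eq_le sqnorm_ge0 andbT leNgt; apply/negP => p0.
have DC : 0 < D * C + 1 by rewrite ltr_wpDl // mulr_ge0.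
have [w /bound hw] := happ _ (divr_gt0 p0 DC).
rewrite ltr_pdivlMr // => lt; have := sqnorm_ge0 (w - f); lra.
Qed.

End MultOp.

(** * Contractive relations *)

Section RangeInclusion.
Context {R : realType}.

Lemma partial_isometry_sqnorm (H K : hilbertType R) (A : H -> K) u :
  partial_isometry A -> (forall v, A v = 0 -> '[u, v] = 0) -> sqnorm (A u) = sqnorm u.
Proof. by move=> piA /piA e; apply: complexI; rewrite -!norm_sqnorm e. Qed.

(** With a = A^* h and b = B^* h, this is |B^* h| <= |A^* h|, which
    expresses B B^* <= A A^* for partial isometries with nested ranges. To
    prove it without adjoint operators, write B b = A f with f orthogonal to
    ker A; then |f| = |A f| = |B b| = |b|, and |b|^2 = <B b, h> = <f, a>, so
    that |f - a|^2 >= 0 gives the claim. *)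
Lemma adjoint_le_of_range_sub (H1 H2 K : hilbertType R) (A : H1 -> K) (B : H2 -> K)
    (h : K) (a : H1) (b : H2) :
  (forall c u v, A (c *: u + v) = c *: A u + A v) ->
  (forall x, (forall e : R, 0 < e -> exists2 w, A w = 0 & sqnorm (w - x) < e) -> A x = 0) ->
  partial_isometry A -> partial_isometry B ->
  (forall v, exists u, B v = A u) ->
  (forall u, '[A u, h] = '[u, a]) -> (forall v, '[B v, h] = '[v, b]) ->
  sqnorm b <= sqnorm a.
Proof.
move=> AL Aclosed piA piB BA adjA adjB; have [f Bf] := BA b.
have A0 : A 0 = 0 by have := AL (-1) 0 0; rewrite scaler0 addr0 scaleN1r addNr.
have subA : subspace [set x | A x = 0].
  by split=> //= c u v u0 v0; rewrite AL u0 v0 scaler0 addr0.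
have [x /= x0 fx] := orthogonal_decomposition f subA Aclosed.
have Afx : A (f - x) = B b by rewrite addrC -scaleN1r AL x0 scaler0 add0r Bf.
(* The vector f - x is the source of B b orthogonal to the kernel of A. *)
have eq1 := partial_isometry_sqnorm piA fx.
have eq2 : sqnorm (B b) = sqnorm b.
  by apply: partial_isometry_sqnorm => // v v0; rewrite hdotC -adjB v0 hdot0l rmorph0.
have eq3 : rdot (f - x) a = sqnorm b by rewrite /rdot -adjA Afx adjB.
have := sqnorm_ge0 (f - x - a); rewrite sqnormB -eq1 Afx eq2 eq3; lra.
Qed.

End RangeInclusion.

Section KernelRelations.
Context {R : realType} {X : Type} {s : X -> X -> R[i]} {Hs : rkhs s}.
Context {F G : hilbertType R} (SF : rkhs_tensor Hs F) (SG : rkhs_tensor Hs G).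
Implicit Type S : set (X * F * G).

Definition ksec (E : hilbertType R) (SE : rkhs_tensor Hs E) x (e : E) : SE :=
  tens SE (kfun Hs x) e.

(** The graph, over finite linear combinations, of the map s_x (x) f |-> s_x
    (x) g for (x, f, g) in S. It is generated inductively, so that
    membership in the span of a union of a chain can be located in one
    member of the chain. *)
Inductive graph_span S : SF * SG -> Prop :=
| graph_span0 : graph_span S 0
| graph_spanD c x f g p : S (x, f, g) -> graph_span S p ->
    graph_span S (c *: (ksec SF x f, ksec SG x g) + p).

Definition contractive_relation S :=
  forall p, graph_span S p -> sqnorm p.2 <= sqnorm p.1.

Lemma graph_span_mono S S' p : S `<=` S' -> graph_span S p -> graph_span S' p.
Proof.
move=> SS'; elim=> [|c x f g q /SS' Sx _ h]; first exact: graph_span0.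
exact: graph_spanD.
Qed.

Lemma graph_span_subspace S : subspace (graph_span S : set (SF * SG)%type).
Proof.
split=> [|a u v]; first exact: graph_span0.
move=> Su Sv; elim: Su => [|c x f g p Sx _ h]; first by rewrite scaler0 add0r.
by rewrite scalerDr scalerA -addrA; exact: graph_spanD.
Qed.

Lemma graph_span_gen S x f g : S (x, f, g) -> graph_span S (ksec SF x f, ksec SG x g).
Proof.
move=> Sx; rewrite -[(_, _)]addr0 -[(_, _)]scale1r; apply: graph_spanD => //.
exact: graph_span0.
Qed.

End KernelRelations.

Section AdjointRelation.
Context {R : realType} {X : Type} {s k : X -> X -> R[i]} {Hs : rkhs s} {Hk : rkhs k}.
Context {E F G : hilbertType R} (KE : rkhs_tensor Hk E).
Context (SF : rkhs_tensor Hs F) (SG : rkhs_tensor Hs G).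
Variables (Phi : X -> {linear F -> E}) (Psi : X -> {linear G -> E}).
Hypotheses (hPhi : multiplier SF KE Phi) (hPsi : multiplier SG KE Psi).

(** The triples (x, Phi(x)^* e, Psi(x)^* e), the adjoints being expressed by
    the pairings that determine them. *)
Definition adjoint_relation : set (X * F * G) :=
  [set t | exists e, (forall f, '[Phi t.1.1 f, e] = '[f, t.1.2]) /\
                     (forall g, '[Psi t.1.1 g, e] = '[g, t.2])].

(** The vector h is the matching combination of the kernel vectors s_x (x) e
    of KE, and the two components of p are its images under the adjoints of
    the multiplication operators. *)
Lemma adjoint_relation_span p : graph_span (SF := SF) (SG := SG) adjoint_relation p ->
  exists h : KE, (forall f, '[mult_op SF KE Phi f, h] = '[f, p.1]) /\
                 (forall g, '[mult_op SG KE Psi g, h] = '[g, p.2]).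
Proof.
elim=> [|c x f g q [e /= [he1 he2]] _ [h [h1 h2]]].
  by exists 0; split=> f /=; rewrite !(hdotC _ 0) !hdot0l.
exists (c *: tens KE (kfun Hk x) e + h); split=> f' /=;
  rewrite !hdotDr !hdotZr !teval_reproducing teval_mult_op //.
- by rewrite h1 he1.
- by rewrite h2 he2.
Qed.

Lemma adjoint_relation_contractive :
  partial_isometry (mult_op SF KE Phi) -> partial_isometry (mult_op SG KE Psi) ->
  range (mult_op SG KE Psi) `<=` range (mult_op SF KE Phi) ->
  contractive_relation SF SG adjoint_relation.
Proof.
move=> piPhi piPsi sub p /adjoint_relation_span [h [h1 h2]].
apply: adjoint_le_of_range_sub piPhi piPsi _ h1 h2.
- exact: mult_opL.
- exact: mult_op_kernel_closed.
- by move=> v; have [u _ <-] := sub _ (ex_intro2 _ _ v I erefl); exists u.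
Qed.

End AdjointRelation.

(** * Gram factorization of positive semi-definite matrices *)

Section PickMatrix.
Context {R : realType}.

Lemma quadratic_formE m n (A : 'M[R[i]]_n) (B : 'M[R[i]]_(m, n)) k :
  (B *m A *m (map_mx Num.conj B^T)) k k =
  \sum_i \sum_j B k i * A i j * (B k j)^*.
Proof.
rewrite mxE exchange_big; apply: eq_bigr => j _ /=; rewrite !mxE mulr_suml.
by apply: eq_bigr => i _.
Qed.

(** By the spectral theorem A is P^* diag(d) P with P unitary and d >= 0; U
    is sqrt(d) times the conjugate of P. *)
Lemma psdmx_gram n (A : 'M[R[i]]_n) : psdmx A -> (forall i j, A i j = (A j i)^*) ->
  exists U : 'M[R[i]]_n, forall i j, A i j = \sum_k U k i * (U k j)^*.
Proof.
move=> psdA hA; have Ah : A \is hermsymmx.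
  by apply/is_hermitianmxP; rewrite expr0 scale1r; apply/matrixP => i j; rewrite !mxE hA.
have /hermitian_normalmx/orthomx_spectralP := Ah.
set P := spectralmx A; set d := spectral_diag A => Aeq.
have Pu : P \is unitarymx := spectral_unitarymx A.
rewrite invmx_unitary // in Aeq.
have AE i j : A i j = \sum_k (P k i)^* * d 0 k * P k j.
  rewrite Aeq mxE; apply: eq_bigr => k _; congr (_ * _).
  rewrite mxE (bigD1 k) //= big1 ?addr0 => [|k' k'k].
    by rewrite !mxE eqxx mulr1n.
  by rewrite !mxE (negPf k'k) mulr0n mulr0.
have d0 k : 0 <= d 0 k.
  have Dk : d 0 k = (P *m A *m map_mx Num.conj P^T) k k.
    have /unitarymxP PP := Pu.
    by rewrite Aeq !mulmxA PP mul1mx -mulmxA PP mulmx1 mxE eqxx mulr1n.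
  have := psdA (row k P); rewrite Dk !quadratic_formE.
  by under eq_bigr => i _ do under eq_bigr => j _ do rewrite !mxE.
exists (\matrix_(k, i) (sqrtC (d 0 k) * (P k i)^*)) => i j.
rewrite AE; apply: eq_bigr => k _; rewrite !mxE.
have rK : sqrtC (d 0 k) ^+ 2 = d 0 k by exact: sqrtCK.
have rJ : (sqrtC (d 0 k))^* = sqrtC (d 0 k).
  by apply/CrealP; rewrite ger0_real // sqrtC_ge0.
by rewrite rmorphM /= conjCK rJ -{1}rK; ring.
Qed.
End PickMatrix.

(** * The Pick kernel at an arbitrary base point *)

Section PickKernel.
Context {R : realType} {X : Type} (s : X -> X -> R[i]).
Hypotheses (sC : forall x y, s x y = (s y x)^*) (s_CNP : complete_NP s).

(** Up to the factor s, the kernel of the space of functions in the RKHS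
    that vanish at y; at the base point where s is normalized, it is 1 -
    1/s. *)
Definition pick_matrix n (x : 'I_n -> X) y : 'M[R[i]]_n :=
  \matrix_(i, j) (1 - s (x i) y * s y (x j) / (s (x i) (x j) * s y y)).

(** A reverse Cauchy-Schwarz inequality. The form 1/s = 1 - (1 - 1/s) is of
    Lorentz type: it is nonpositive on combinations whose coefficients sum
    to 0. Hence for any combination d the value Q = [d, d] of the form
    satisfies Q [w, w] <= |[d, w]|^2, w being the unit mass at y, for which
    [w, w] = 1/s(y,y) > 0: apply the first fact to d - D w, where D is the
    sum of the coefficients of d. Rescaling the coefficients v by s(., y)
    turns this into the claim. *)
Lemma psd_pick_matrix n (x : 'I_n -> X) y : 0 < s y y -> psdmx (pick_matrix x y).
Proof.
move=> syy v; have [s0 L] := s_CNP.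
rewrite quadratic_formE.
pose d i := v 0 i * s (x i) y; pose D := \sum_i d i; pose V := \sum_i v 0 i.
pose Q := \sum_i \sum_j d i * (s (x i) (x j))^-1 * (d j)^*.
pose S := s y y; have S0 : S != 0 by exact: s0.
have SJ : S^* = S by rewrite -sC.
have dV i : d i / s (x i) y = v 0 i by rewrite /d mulfK.
have dJ j : (d j)^* = (v 0 j)^* * s y (x j) by rewrite rmorphM /= -sC.
have -> : \sum_i \sum_j v 0 i * pick_matrix x y i j * (v 0 j)^* = V * V^* - Q / S.
  rewrite /V rmorph_sum mulr_suml /Q mulr_suml -sumrB; apply: eq_bigr => i _.
  rewrite mulr_sumr mulr_suml -sumrB; apply: eq_bigr => j _.
  by rewrite mxE dJ /d -/S; field; rewrite S0 s0.
(* Positivity of 1 - 1/s at the points x_i and y, with coefficients d_i and - D: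
   they sum to 0, so the constant 1 contributes nothing. *)
have posX : 0 <= V * D^* + V^* * D - Q - D * D^* / S.
  have := L n.+1 (fun i => if unlift ord0 i is Some j then x j else y)
    (\row_i if unlift ord0 i is Some j then d j else - D).
  rewrite quadratic_formE big_ord_recl.
  under eq_bigr => j _ do rewrite !mxE.
  under [X in _ + X]eq_bigr => i _ do under eq_bigr => j _ do rewrite !mxE.
  rewrite big_ord_recl /= unlift_none.
  under eq_bigr => j _ do rewrite liftK.
  under [X in _ + X]eq_bigr => i _ do rewrite big_ord_recl unlift_none liftK.
  under [X in _ + X]eq_bigr => i _ do under eq_bigr => j _ do rewrite liftK.
  have -> : \sum_(j < n) - D * (1 - (s y (x j))^-1) * (d j)^* = - D * (D^* - V^*).
    rewrite /V /D !rmorph_sum -sumrB mulr_sumr; apply: eq_bigr => j _ /=.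
    by rewrite dJ; field.
  rewrite big_split /=.
  have -> : \sum_(i < n) d i * (1 - (s (x i) y)^-1) * (- D)^* = (D - V) * (- D)^*.
    rewrite {2}/D /V -sumrB mulr_suml; apply: eq_bigr => i _ /=.
    by rewrite /d; field.
  have -> : \sum_(i < n) \sum_j d i * (1 - (s (x i) (x j))^-1) * (d j)^* = D * D^* - Q.
    rewrite /D rmorph_sum mulr_suml /Q -sumrB; apply: eq_bigr => i _ /=.
    rewrite mulr_sumr -sumrB; apply: eq_bigr => j _ /=.
    by rewrite mulrBr mulr1 mulrBl.
  by rewrite -/S rmorphN /=; congr (0 <= _); field.
have posY : 0 <= (V - D / S) * (V - D / S)^*.
  by rewrite -normCK exprn_ge0.
have -> : V * V^* - Q / S = (V - D / S) * (V - D / S)^* + S^-1 * (V * D^* + V^* * D - Q - D * D^* / S).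
  by rewrite rmorphB rmorphM fmorphV /= SJ; field.
by rewrite addr_ge0 // mulr_ge0 // invr_ge0 ltW.
Qed.

End PickKernel.

(** * Removing the component along a kernel vector *)

Section OnePointExtension.
Context {R : realType} {X : Type} {s : X -> X -> R[i]} {Hs : rkhs s}.
Hypothesis s_CNP : complete_NP s.

Lemma rkhs_kernel_herm x y : s x y = (s y x)^*.
Proof. by rewrite -!(kfunE Hs) -!(reproducing (r := Hs)) hdotC. Qed.

Lemma rkhs_diag y : s y y = (sqnorm (kfun Hs y))%:C.
Proof. by rewrite -hdot_sqnorm reproducing kfunE. Qed.

Lemma rkhs_diag_gt0 y : 0 < sqnorm (kfun Hs y).
Proof.
rewrite lt_def sqnorm_ge0 andbT; apply/eqP => y0.
by have /eqP := s_CNP.1 y y; rewrite rkhs_diag y0; apply.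
Qed.

(** The left-hand side is s(y,y) times the squared norm of the component of
    a orthogonal to s_y (x) E. Its kernel is the Schur product of s with the
    Pick matrix, so a Gram factorization of the latter splits it into
    squared norms of combinations of the same vectors; the coefficients
    depend on the points only, not on E. *)
Lemma compression_gram (E : hilbertType R) (SE : rkhs_tensor Hs E) n (c : 'I_n -> R[i])
    (x : 'I_n -> X) (e : 'I_n -> E) y (U : 'M[R[i]]_n) :
  (forall i j, pick_matrix s x y i j = \sum_k U k i * (U k j)^*) ->
  let a := \sum_i c i *: ksec SE (x i) (e i) in
  sqnorm (kfun Hs y) * sqnorm a - sqnorm (teval SE y a) =
  sqnorm (kfun Hs y) *
    \sum_k sqnorm (\sum_i (c i * (U k i)^*) *: ksec SE (x i) (e i)).
Proof.
move=> hU a; apply: complexI; rewrite rmorphB !rmorphM rmorph_sum /= -!hdot_sqnorm.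
have s0 := s_CNP.1.
under eq_bigr => k _ do rewrite -hdot_sqnorm.
have sesq (H : hilbertType R) (b b' : 'I_n -> R[i]) (u v : 'I_n -> H) :
    '[\sum_i b i *: u i, \sum_i b' i *: v i] =
    \sum_i \sum_j b i * (b' j)^* * '[u i, v j].
  rewrite hdot_suml; apply: eq_bigr => i _.
  rewrite hdot_sumr; apply: eq_bigr => j _.
  by rewrite hdotZl hdotZr mulrA.
have -> : teval SE y a = \sum_i (c i * s y (x i)) *: e i.
  rewrite /a linear_sum; apply: eq_bigr => i _ /=.
  by rewrite linearZ_LR teval_tens kfunE scalerA.
rewrite /a !sesq.
under [in RHS]eq_bigr => k _ do rewrite sesq.
rewrite [in RHS]exchange_big /= !mulr_sumr -sumrB; apply: eq_bigr => i _.
rewrite exchange_big /= !mulr_sumr -sumrB; apply: eq_bigr => j _.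
rewrite /ksec hdot_tens reproducing kfunE.
transitivity (s y y * (c i * (c j)^* * (s (x j) (x i) * '[e i, e j]) * pick_matrix s x y j i)).
  rewrite mxE reproducing kfunE rmorphM /= -(rkhs_kernel_herm (x j) y).
  by field; rewrite !s0.
rewrite hU mulr_sumr reproducing kfunE; congr (_ * _); apply: eq_bigr => k _.
by rewrite rmorphM /= conjCK; ring.
Qed.

Context {F G : hilbertType R} {SF : rkhs_tensor Hs F} {SG : rkhs_tensor Hs G}.
Implicit Type S : set (X * F * G).

Lemma graph_span_sum S (p : SF * SG) : graph_span S p ->
  exists n (c : 'I_n -> R[i]) (t : 'I_n -> X * F * G), (forall i, S (t i)) /\
   p = (\sum_i c i *: ksec SF (t i).1.1 (t i).1.2, \sum_i c i *: ksec SG (t i).1.1 (t i).2).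
Proof.
elim=> [|c x f g q Sx _ [n [d [t [St ->]]]]].
  by exists 0%N, (fun _ => 0), (fun i : 'I_0 => False_rect _ (notF (ltn_ord i))); split=> [[]//|]; rewrite !big_ord0.
exists n.+1, (fun i => if unlift ord0 i is Some j then d j else c),
  (fun i => if unlift ord0 i is Some j then t j else (x, f, g)).
split=> [i|]; first by case: unlift.
rewrite !big_ord_recl unlift_none /=.
rewrite [LHS]surjective_pairing /=.
by congr (_, _); congr (_ + _); apply: eq_bigr => j _; rewrite liftK.
Qed.

(** Schur product argument: [compression_gram] expresses both sides, with
    the same matrix U, as sums of squared norms of the two components of
    elements of the span, and these are compared term by term. *)
Lemma graph_span_compression S (p : SF * SG) y :
  contractive_relation SF SG S -> graph_span S p ->
  sqnorm (kfun Hs y) * sqnorm p.2 - sqnorm (teval SG y p.2) <=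
  sqnorm (kfun Hs y) * sqnorm p.1 - sqnorm (teval SF y p.1).
Proof.
move=> Sc /graph_span_sum [n [c [t [St ->]]]] /=.
pose x i := (t i).1.1.
have psd : psdmx (pick_matrix s x y).
  apply: psd_pick_matrix => //; first exact: rkhs_kernel_herm.
  by rewrite rkhs_diag -[0]/(0%:C) ltcR rkhs_diag_gt0.
have [|U hU] := psdmx_gram psd.
  move=> i j; rewrite !mxE rmorphB rmorphM fmorphV rmorphM /= rmorph1 rmorphM /=.
  by rewrite -!rkhs_kernel_herm [in LHS](mulrC (s _ y)) .
rewrite !(compression_gram _ _ _ hU) ler_pM2l ?rkhs_diag_gt0 //.
apply: ler_sum => k _.
have : graph_span S (\sum_i (c i * (U k i)^*) *: ksec SF (x i) (t i).1.2,
                     \sum_i (c i * (U k i)^*) *: ksec SG (x i) (t i).2).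
  apply: (big_rec2 (fun a b => graph_span S (a, b))); first exact: graph_span0.
  move=> i a b _ Sab.
  apply: (@graph_spanD _ _ _ _ _ _ SF SG _ (c i * (U k i)^*) (x i) (t i).1.2 (t i).2 _ _ Sab).
  by have := St i; rewrite /x; case: (t i) => [[]].
by move=> /Sc.
Qed.

End OnePointExtension.

(** * Extension of contractive relations *)

Section Extension.
Context {R : realType} {X : Type} {s : X -> X -> R[i]} {Hs : rkhs s}.
Hypothesis s_CNP : complete_NP s.
Context {F G : hilbertType R} (SF : rkhs_tensor Hs F) (SG : rkhs_tensor Hs G).
Implicit Type S : set (X * F * G).

Lemma graph_span_setU1 S x f g (p : SF * SG) :
  graph_span (S `|` [set (x, f, g)]) p ->
  exists q c, graph_span S q /\ p = q + c *: (ksec SF x f, ksec SG x g).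
Proof.
elim=> [|c x' f' g' q [Sx|[-> -> ->]] _ [q' [d [Sq' ->]]]].
- by exists 0, 0; split; [exact: graph_span0|rewrite scale0r addr0].
- exists (c *: (ksec SF x' f', ksec SG x' g') + q'), d.
  by split; [exact: graph_spanD|rewrite addrA].
- by exists q', (c + d); split=> //; rewrite scalerDl addrCA.
Qed.

Lemma sqnorm_ksec_add (E : hilbertType R) (SE : rkhs_tensor Hs E) (a : SE) x e :
  sqnorm (a + ksec SE x e) =
  sqnorm a + 2 * rdot (teval SE x a) e + sqnorm (kfun Hs x) * sqnorm e.
Proof. by rewrite sqnormD sqnorm_tens /rdot teval_reproducing. Qed.

(** Put k = s(y,y) and v = s_y (x) f0. The condition on g0 is |b + s_y (x)
    g0|^2 <= |a + v|^2 for (a, b) in the span of S. Multiplied by k and with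
    x = - k g0, it reads |b(y) - x|^2 <= J(a, b) for the function J below,
    which says that x is a common point of the balls of radius sqrt(J)
    around the vectors b(y). The function J is nonnegative by
    [graph_span_compression], because adding v changes only the component
    along s_y; it is strongly convex because S is contractive; so the
    minimiser is such a point. *)
Lemma contractive_one_point_extension S y (f0 : F) : contractive_relation SF SG S ->
  exists g0 : G, contractive_relation SF SG (S `|` [set (y, f0, g0)]).
Proof.
move=> Sc; have [S0 SL] := graph_span_subspace SF SG S.
pose k := sqnorm (kfun Hs y); have k0 : 0 < k := rkhs_diag_gt0 s_CNP y.
pose v := ksec SF y f0.
pose J (p : SF * SG) := k * (sqnorm (p.1 + v) - sqnorm p.2) + sqnorm (teval SG y p.2).
(* With z = p.1(y) + k f0, the value at y of p.1 + v, the components of p.1 + v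
   and of p.1 orthogonal to s_y (x) F agree, and J p exceeds the difference in
   [graph_span_compression] by |z|^2. *)
have J0 p : graph_span S p -> 0 <= J p.
  move=> Sp; have := graph_span_compression s_CNP y Sc Sp; rewrite -/k /J => h.
  rewrite /v sqnorm_ksec_add -/k.
  have := sqnorm_ge0 (teval SF y p.1 + k%:C *: f0).
  by rewrite sqnormD sqnormZr rdotZr; lra.
have [|||x [hx _]] := @strongly_convex_minimiser R {p | graph_span S p} G
  (fun p => J (sval p)) (fun p => teval SG y (sval p).2).
- by split; exists 0.
- by case=> p /= /J0.
- move=> [p Sp] [q Sq] t /= /andP[t0 t1].
  have Sz (a : R[i]) (z : SF * SG) : graph_span S z -> graph_span S (a *: z).
    by move=> Sz; rewrite -[_ *: z]addr0; exact: SL.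
  exists (exist _ _ (SL (1 - t)%:C _ _ Sp (Sz t%:C _ Sq))) => /=.
  rewrite /J /=.
  have -> : (1 - t)%:C *: p.1 + t%:C *: q.1 + v =
            (1 - t)%:C *: (p.1 + v) + t%:C *: (q.1 + v).
    by rewrite !scalerDr addrACA -scalerDl -rmorphD subrK scale1r.
  rewrite linearP linearZ_LR /= !sqnorm_convex.
  have -> : q.1 + v - (p.1 + v) = q.1 - p.1 by rewrite opprD addrACA subrr addr0.
  have : graph_span S (-1 *: p + q) by exact: SL.
  move=> /Sc /=; rewrite !scaleN1r ![- _ + _]addrC.
  set D1 := sqnorm (q.1 - p.1); set D2 := sqnorm (q.2 - p.2) => D21.
  have : 0 <= t * (1 - t) * (k * (D1 - D2)).
    by do ?apply: mulr_ge0; lra.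
  by lra.
exists ((- k^-1)%:C *: x) => p' /graph_span_setU1 [q [c [Sq ->]]] /=.
have key p : graph_span S p ->
    sqnorm (p.2 + ksec SG y ((- k^-1)%:C *: x)) <= sqnorm (p.1 + v).
  move=> Sp; have := hx (exist _ p Sp); rewrite /= /J.
  rewrite sqnorm_ksec_add -/k sqnormB rdotZr sqnormZr.
  set r := rdot _ x; set n := sqnorm x => h.
  rewrite -(ler_pM2l k0).
  have -> : k * (sqnorm p.2 + 2 * (- k^-1 * r) + k * ((- k^-1) ^+ 2 * n)) =
            k * sqnorm p.2 - 2 * r + n by field; rewrite gt_eqF.
  by lra.
have [-> | c0] := eqVneq c 0; first by rewrite !scale0r !addr0; exact: Sc.
have -> : q = c *: (c^-1 *: q) by rewrite scalerA mulfV ?scale1r.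
rewrite -!scalerDr !sqnormZ ler_wpM2l ?addr_ge0 ?sqr_ge0 //.
by apply: key; rewrite -[_ *: q]addr0; exact: SL.
Qed.

(** A maximal contractive relation containing S is total, since otherwise
    [contractive_one_point_extension] would enlarge it. *)
Lemma contractive_relation_total S : contractive_relation SF SG S ->
  exists T, [/\ S `<=` T, contractive_relation SF SG T &
    forall x f, exists g, T (x, f, g)].
Proof.
move=> Sc.
have [|A [SA Amax]] := @Zorn_bigcup _ [set A | contractive_relation SF SG (S `|` A)].
  move=> C CP Ctot p Sp.
  (* The empty set stands for the member of the chain when p only involves
     triples of S, as it does if the chain is empty. *)
  have [A [-> | CA] {}Sp] : exists2 A : set (X * F * G), A = classical_sets.set0 \/ C A & graph_span (S `|` A) p.
    elim: Sp => [|c x f g q Sx _ [A hA Sq]].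
      by exists classical_sets.set0; [left|exact: graph_span0].
    case: Sx => [Sx|[B CB Bx]].
      by exists A => //; apply: graph_spanD => //; left.
    case: hA => [A0|CA].
      exists B; [by right|]; apply: graph_spanD; first by right.
      by apply: graph_span_mono Sq => t [] // St; [left|rewrite A0 in St].
    have [AB|BA] := Ctot _ _ CA CB.
      exists B; [by right|]; apply: graph_spanD; first by right.
      by apply: graph_span_mono Sq => t [St|/AB]; [left|right].
    by exists A; [right|apply: graph_spanD => //; right; apply: BA].
  - by apply: Sc; apply: graph_span_mono Sp => t [].
  - exact: CP _ CA _ Sp.
exists (S `|` A); split=> [t St|p Sp|x f]; [by left|exact: SA|].
have [g hg] := contractive_one_point_extension x f SA.
exists g; right; apply: contrapT => nA.
apply: (Amax (A `|` [set (x, f, g)])); last by rewrite /= classical_sets.setUA.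
by split=> [t|/(_ (x, f, g))]; [left|move=> /(_ (or_intror erefl))].
Qed.

End Extension.

(** * From total contractive relations to multipliers *)

Section MultiplierOfRelation.
Context {R : realType} {X : Type} {s : X -> X -> R[i]} {Hs : rkhs s}.
Hypothesis s_CNP : complete_NP s.
Context {F G : hilbertType R} (SF : rkhs_tensor Hs F) (SG : rkhs_tensor Hs G).
Variable T : set (X * F * G).
Hypothesis Tc : contractive_relation SF SG T.

Lemma ksecL (E : hilbertType R) (SE : rkhs_tensor Hs E) x a e e' :
  ksec SE x (a *: e + e') = a *: ksec SE x e + ksec SE x e'.
Proof. by rewrite /ksec linearDr linearZr_LR. Qed.

Lemma contractive_relation_bounded x f g : T (x, f, g) -> sqnorm g <= sqnorm f.
Proof.
move=> Tg; have /= := Tc (graph_span_gen SF SG Tg).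
by rewrite !sqnorm_tens ler_pM2l ?(rkhs_diag_gt0 s_CNP).
Qed.

(** The combination of the three triples has first component 0, so its
    second component vanishes. *)
Lemma contractive_relation_linear x a f f' g g' h :
  T (x, f, g) -> T (x, f', g') -> T (x, a *: f + f', h) -> h = a *: g + g'.
Proof.
move=> /(graph_span_gen SF SG) Tg /(graph_span_gen SF SG) Tg' /(graph_span_gen SF SG) Th.
have [_ SL] := graph_span_subspace SF SG T.
have /= := Tc (SL (-1) _ _ Th (SL a _ _ Tg Tg')).
rewrite /= -!ksecL !scaleN1r addNr /ksec !sqnorm_tens /sqnorm /rdot hdot0l mulr0.
rewrite pmulr_rle0 ?(rkhs_diag_gt0 s_CNP) // => le0.
apply/esym/eqP; rewrite -subr_eq0 addrC; apply/eqP/sqnorm_eq0.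
by apply/eqP; rewrite eq_le sqnorm_ge0 le0.
Qed.

(** Let A(x) be the operator with graph T at x and Gamma(x) its adjoint. For
    g in SG, the function Gamma g is the vector representing the functional
    (a, b) |-> <b, g> on the span of T, which is bounded by |g| |a| since
    |b| <= |a| there. *)
Lemma contractive_multiplier_of_relation :
  (forall x f, exists g, T (x, f, g)) ->
  exists Gamma : X -> {linear G -> F},
    [/\ multiplier SG SF Gamma, contractive (mult_op SG SF Gamma) &
      forall x f g, T (x, f, g) -> forall v, '[Gamma x v, f] = '[v, g]].
Proof.
move=> Ttot; have /choice[A' hA'] (t : X * F) : exists g, T (t, g).
  by case: t => x f; exact: Ttot.
pose A x f := A' (x, f); have hA x f : T (x, f, A x f) := hA' (x, f).
have AL x a f f' : A x (a *: f + f') = a *: A x f + A x f'.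
  exact: contractive_relation_linear (hA x f) (hA x f') (hA x _).
have A_le x f : sqnorm (A x f) <= sqnorm f := contractive_relation_bounded (hA x f).
have /choice[B' hB'] (t : X * G) : exists u : F, forall f, '[A t.1 f, t.2] = '[f, u].
  by apply: (bounded_adjoint_vector _ ler01 (AL t.1)) => f; rewrite mul1r.
pose B x v := B' (x, v); have hB x v f : '[A x f, v] = '[f, B x v] := hB' (x, v) f.
have BL x : linear (B x).
  by move=> a u v; apply: hdot_inj => w; rewrite -hB !hdotDr !hdotZr -!hB.
pose Gam x : {linear G -> F} := HB.pack (B x) (GRing.isLinear.Build R[i] G F *:%R (B x) (BL x)).
(* |A B v|^2 <= |B v|^2 and <A B v, v> = |B v|^2, so expanding
   |A B v - v|^2 >= 0 bounds B by 1. *)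
have B_le x v : sqnorm (B x v) <= sqnorm v.
  have := A_le x (B x v); have := sqnorm_ge0 (A x (B x v) - v).
  by rewrite sqnormB /rdot hB -/(rdot _ _) -/(sqnorm (B x v)); lra.
have mult g : exists h, (forall x, teval SF x h = Gam x (teval SG x g)) /\
    sqnorm h <= sqnorm g.
  have [|||h [hh hle _]] := @riesz_on R (SF * SG)%type (graph_span T) SF fst
    (fun p => '[p.2, g]) (sqnorm g) (graph_span_subspace SF SG T).
  - by [].
  - by move=> a u v /=; rewrite hdotDl hdotZl.
  - move=> p Tp; have := sqnorm_ge0 (p.2 - g); have := Tc Tp.
    by rewrite sqnormB -/(rdot _ _); lra.
  exists h; split=> // x; apply: hdot_inj => f; rewrite -hB.
  rewrite [LHS]hdotC [RHS]hdotC -!teval_reproducing; congr (_^*).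
  have /hh /= := graph_span_gen SF SG (hA x f).
  by rewrite [LHS]hdotC [RHS]hdotC => /(can_inj conjCK).
have multGam : multiplier SG SF Gam.
  split=> [x|g]; last by have [h [hh _]] := mult g; exists h.
  by apply: (@sqnorm_bounded_continuous _ _ _ (Gam x) 1) => // u; rewrite mul1r; exact: B_le.
exists Gam; split=> // [g|x f g Tg v].
  have [h [/(mult_opP multGam) -> hle]] := mult g.
  by rewrite ler_norm_sqnorm.
have -> : g = A x f.
  have := contractive_relation_linear (a := 0) (hA x f) Tg.
  by rewrite !scale0r !add0r => /(_ _ (hA x f)) ->.
by rewrite [RHS]hdotC hB -hdotC.
Qed.

End MultiplierOfRelation.

Theorem theorem1p3 (R : realType) (X : Type) (k s : X -> X -> R[i])
    (hk : is_kernel k)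
    (hs : is_kernel s) (s_normalized : normalized s) (s_CNP : complete_NP s)
    (hks : is_kernel (fun x y => k x y / s x y))
    (Hk : rkhs k) (Hs : rkhs s)
    (E F G : hilbertType R)
    (KE : rkhs_tensor Hk E) (SF : rkhs_tensor Hs F) (SG : rkhs_tensor Hs G)
    (N M : set KE)
    (hN : closed_subspace N) (hM : closed_subspace M)
    (N_neq0 : N <> [set 0]) (M_neq0 : M <> [set 0])
    (NM : N `<=` M)
    (Phi : X -> {linear F -> E}) (Psi : X -> {linear G -> E})
    (hPhi : multiplier SF KE Phi) (hPsi : multiplier SG KE Psi)
    (Phi_pi : partial_isometry (mult_op SF KE Phi))
    (Psi_pi : partial_isometry (mult_op SG KE Psi))
    (M_range : M = range (mult_op SF KE Phi))
    (N_range : N = range (mult_op SG KE Psi)) :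
  exists Gamma : X -> {linear G -> F},
    [/\ multiplier SG SF Gamma,
        contractive (mult_op SG SF Gamma)
      & forall x (v : G), Psi x v = Phi x (Gamma x v)].
Proof.
have sub : range (mult_op SG KE Psi) `<=` range (mult_op SF KE Phi).
  by rewrite -M_range -N_range.
have Sc := adjoint_relation_contractive hPhi hPsi Phi_pi Psi_pi sub.
have [T [ST Tc Ttot]] := contractive_relation_total s_CNP Sc.
have [Gam [multGam cGam GamT]] := contractive_multiplier_of_relation s_CNP Tc Ttot.
exists Gam; split=> // x v; apply: hdot_inj => e.
have [f hf] := adjoint_vector e (hPhi.1 x).
have [g hg] := adjoint_vector e (hPsi.1 x).
have /ST /GamT /(_ v) Gv : adjoint_relation Phi Psi (x, f, g) by exists e.
by rewrite [LHS]hdotC [RHS]hdotC hf hg Gv.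
Qed.
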